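(* Let $(x,y)\in\mathfrak O$, put $m=\max\{x,y\}$, and, when $m>0$, set $$r:=\frac{\min\{x,y\}}{m}\in[0,1].$$ For $1/2<r\le 1$ define $$p(r):=\frac{2r^2-4r-3}{12r^2},\qquad q(r):=\frac{2r-1}{12r},\qquad \vartheta(r):=\frac13\arccos\left(\frac{3q(r)}{2p(r)}\sqrt{-\frac{3}{p(r)}}\right),$$ and define $\omega:[0,1]\to\mathbb R$ by $$\omega(r):=\begin{cases}1,&0\le r\le\frac12,\\[1mm] \displaystyle\frac1{2r}+2\sqrt{-\frac{p(r)}3}\,\cos\left(\vartheta(r)-\frac{2\pi}{3}\right),&\frac12<r\le1.\end{cases}$$ Then $\mathfrak B_{\mathfrak O}(0,0)=0$, and for $m>0$, $$\mathfrak B_{\mathfrak O}(x,y)=2m\sqrt{H\bigl(r,\omega(r)\bigr)}.$$ For $r>1/2$, the number $\omega(r)$ is the unique zero of $d_r$ in the open interval $(\tau,1)$; in particular $\tau<\omega(r)<1$. Moreover, if $m>0$ and $x\ge y$, then the polynomial $$P_r(\xi,\eta)=-\xi^2+\bigl(1+3\omega(r)\bigr)\xi\eta+\frac{1-3\omega(r)^2}{2}\eta^2$$ satisfies $\|P_r\|_{\mathfrak O}=1$ and $\|\nabla P_r(x,y)\|_2=\mathfrak B_{\mathfrak O}(x,y)$, and the same holds for $-P_r$. If $m>0$ and $y\ge x$, the same holds for $\pm$ the polynomial obtained by interchanging the first and third coefficients, namely $\frac{1-3\omega(r)^2}{2}\xi^2+(1+3\omega(r))\xi\eta-\eta^2$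.
   Context: $\mathfrak O:=\{(x,y)\in[0,1]^2: x+y\le\sqrt2\}$ and $\tau:=\sqrt2-1$. $\mathcal P({}^2\mathbb R^2)$ is the three-dimensional real vector space of quadratic forms $P(x,y)=ax^2+bxy+cy^2$ with $a,b,c\in\mathbb R$, normed by $\|P\|_{\mathfrak O}:=\sup_{(x,y)\in\mathfrak O}|P(x,y)|$. $\nabla P=(\partial P/\partial x,\partial P/\partial y)$ and $\|\cdot\|_2$ is the Euclidean norm on $\mathbb R^2$. The Bernstein function is $$\mathfrak B_{\mathfrak O}(x,y):=\sup\{\|\nabla P(x,y)\|_2: P\in\mathcal P({}^2\mathbb R^2),\ \|P\|_{\mathfrak O}\le1\}.$$ The function $H$ is $$H(r,u):=\left[-1+\frac{1+3u}{2}r\right]^2+\left[\frac{1+3u}{2}+\frac{1-3u^2}{2}r\right]^2,$$ and for $0<r\le1$ the cubic $d_r$ is $$d_r(u):=6r^2u^3-9ru^2+(r^2-2r+3)u+(r^2-r+1).$$ *)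

(* Defs.v *)
From mathcomp Require Import all_boot all_order all_algebra.
From mathcomp Require Import ring lra.
From mathcomp Require Import all_classical all_reals all_analysis.

Set Implicit Arguments.
Unset Strict Implicit.
Unset Printing Implicit Defensive.

Import Order.TTheory GRing.Theory Num.Theory.
Import numFieldNormedType.Exports.

Local Open Scope classical_set_scope.
Local Open Scope ring_scope.

Definition quarter_octagon {R : realType} : set (R * R) :=
  [set z | [/\ 0 <= z.1 <= 1, 0 <= z.2 <= 1 & z.1 + z.2 <= Num.sqrt 2]].

Definition tau {R : realType} : R := Num.sqrt 2 - 1.

Definition qform {R : realType} (a b c : R) : R * R -> R :=
  fun z => a * z.1 ^+ 2 + b * z.1 * z.2 + c * z.2 ^+ 2.

Definition quadratic_forms {R : realType} : set (R * R -> R) :=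
  [set P | exists a b c : R, P = qform a b c].

(* [sup] is 0 on sets without a supremum; [has_sup_qoct_norm] and
   [has_sup_bernstein] below show that this default value is never used. *)
Definition qoct_norm {R : realType} (P : R * R -> R) : R :=
  sup [set `|P z| | z in quarter_octagon].

Definition gradient {R : realType} (P : R * R -> R) (z : R * R) : R * R :=
  (derive1 (fun t => P (t, z.2)) z.1, derive1 (fun t => P (z.1, t)) z.2).

(* The library norm on [R * R] is the max norm. *)
Definition norm2 {R : realType} (v : R * R) : R :=
  Num.sqrt (v.1 ^+ 2 + v.2 ^+ 2).

Definition bernstein {R : realType} (z : R * R) : R :=
  sup [set norm2 (gradient P z) |
        P in [set P | quadratic_forms P /\ qoct_norm P <= 1]].

Definition Hfun {R : realType} (r u : R) : R :=
  (- 1 + (1 + 3 * u) / 2 * r) ^+ 2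
  + ((1 + 3 * u) / 2 + (1 - 3 * u ^+ 2) / 2 * r) ^+ 2.

Definition dcubic {R : realType} (r u : R) : R :=
  6 * r ^+ 2 * u ^+ 3 - 9 * r * u ^+ 2 + (r ^+ 2 - 2 * r + 3) * u
  + (r ^+ 2 - r + 1).

Definition pcoef {R : realType} (r : R) : R :=
  (2 * r ^+ 2 - 4 * r - 3) / (12 * r ^+ 2).

Definition qcoef {R : realType} (r : R) : R := (2 * r - 1) / (12 * r).

Definition vartheta_arg {R : realType} (r : R) : R :=
  3 * qcoef r / (2 * pcoef r) * Num.sqrt (- (3 / pcoef r)).

Definition vartheta {R : realType} (r : R) : R := 1 / 3 * acos (vartheta_arg r).

Definition omega {R : realType} (r : R) : R :=
  if r <= 1 / 2 then 1
  else 1 / (2 * r)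
       + 2 * Num.sqrt (- (pcoef r / 3)) * cos (vartheta r - 2 * pi / 3).

Section well_defined.
Context {R : realType}.
Implicit Types (a b c r : R) (z : R * R).

Lemma has_sup_qoct_norm a b c :
  has_sup [set `|qform a b c z| | z in quarter_octagon].
Proof.
split.
  exists `|qform a b c (0, 0)|, (0, 0) => //; split => /=.
  - by rewrite lexx ler01.
  - by rewrite lexx ler01.
  - by rewrite addr0 sqrtr_ge0.
exists (`|a| + `|b| + `|c|) => _ [z [/andP[x0 x1] /andP[y0 y1] _] <-].
have le1 (s t : R) : 0 <= t <= 1 -> `|s * t| <= `|s|.
  by move=> /andP[t0 t1]; rewrite normrM (ger0_norm t0) ler_piMr.
rewrite /qform; apply: le_trans (ler_normD _ _) _; apply: lerD; last first.
  by apply: le1; rewrite exprn_ge0// exprn_ile1.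
apply: le_trans (ler_normD _ _) _; apply: lerD.
  by apply: le1; rewrite exprn_ge0// exprn_ile1.
by rewrite -mulrA; apply: le1; rewrite mulr_ge0// mulr_ile1.
Qed.

Lemma qoct_norm_ub a b c z : quarter_octagon z ->
  `|qform a b c z| <= qoct_norm (qform a b c).
Proof.
move=> Oz; apply: ub_le_sup; last by exists z.
exact: (has_sup_qoct_norm a b c).2.
Qed.

Lemma gradient_qform a b c z : gradient (qform a b c) z =
  (2 * a * z.1 + b * z.2, b * z.1 + 2 * c * z.2).
Proof.
have D (k l m s : R) :
    derive1 (fun t => k * t ^+ 2 + l * t + m) s = 2 * k * s + l.
  have -> : (fun t => k * t ^+ 2 + l * t + m)
      = cst k * (@id R ^+ 2) + cst l * @id R + cst m.
    by apply/funext => t; rewrite !fctE.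
  rewrite derive1E derive_val /GRing.scale/= !fctE expr1.
  by ring.
rewrite /gradient /qform; congr pair => /=.
- under eq_fun do rewrite [b * _ * _]mulrAC.
  by rewrite D.
- rewrite (_ : (fun t => _) =
    (fun t => c * t ^+ 2 + b * z.1 * t + a * z.1 ^+ 2)); last first.
    by apply/funext => t; ring.
  by rewrite D addrC.
Qed.

Lemma has_sup_bernstein z :
  has_sup [set norm2 (gradient P z) |
            P in [set P | quadratic_forms P /\ qoct_norm P <= 1]].
Proof.
have s2 : 1 <= Num.sqrt 2 :> R by rewrite -{1}sqrtr1 ler_sqrt// ler1n.
split.
  exists (norm2 (gradient (qform 0 0 0) z)), (qform 0 0 0) => //.
  split; first by exists 0, 0, 0.
  apply: ge_sup; first by case: (has_sup_qoct_norm 0 0 0).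
  by move=> _ [t _ <-]; rewrite /qform !mul0r !addr0 normr0 ler01.
pose K := `|z.1| + `|z.2|.
exists (Num.sqrt ((8 * K) ^+ 2 + (8 * K) ^+ 2)) => _ [_ [[a [b [c ->]]] P1] <-].
have le1 t : quarter_octagon t -> `|qform a b c t| <= 1.
  by move=> Ot; apply: le_trans P1; exact: qoct_norm_ub.
have := le1 (1, 0); have := le1 (0, 1); have := le1 (1 / 2, 1 / 2).
rewrite /quarter_octagon /qform /= => h3 h2 h1.
have {}h1 : `|a| <= 1.
  move: h1; rewrite !mulr0 expr0n/= expr1n mulr1 mulr0 !addr0; apply.
  by split=> //; apply/andP; split; lra.
have {}h2 : `|c| <= 1.
  move: h2; rewrite !mulr0 expr0n/= expr1n mul0r mulr0 mulr1 !add0r; apply.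
  by split=> //; apply/andP; split; lra.
have {}h3 : `|b| <= 6.
  have : `|a * (1 / 2) ^+ 2 + b * (1 / 2) * (1 / 2) + c * (1 / 2) ^+ 2| <= 1.
    by apply: h3; split; [apply/andP; split| apply/andP; split|]; lra.
  move: h1 h2; rewrite !ler_norml => /andP[a0 a1] /andP[c0 c1] /andP[e0 e1].
  by apply/andP; split; lra.
have bnd (s t u v : R) : `|s| <= 6 -> `|t| <= 6 ->
    (s * u + t * v) ^+ 2 <= (8 * (`|u| + `|v|)) ^+ 2.
  move=> s6 t6; rewrite -real_normK ?num_real//.
  apply: lerXn2r; rewrite ?nnegrE ?mulr_ge0 ?addr_ge0//.
  apply: le_trans (ler_normD _ _) _; rewrite !normrM mulrDr.
  by apply: lerD; apply: ler_wpM2r => //; lra.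
have two (s : R) : `|s| <= 1 -> `|2 * s| <= 6.
  by move=> s1; rewrite normrM ger0_norm//; lra.
rewrite gradient_qform /norm2 /= ler_sqrt ?addr_ge0 ?sqr_ge0//.
by apply: lerD; apply: bnd => //; exact: two.
Qed.

Lemma vartheta_arg_bounded r : 1 / 2 < r <= 1 -> - 1 <= vartheta_arg r <= 1.
Proof.
move=> /andP[r0 r1].
have rp : 0 < r by lra.
have p0 : pcoef r < 0.
  rewrite /pcoef ltr_pdivrMr; last by rewrite mulr_gt0// exprn_gt0.
  by rewrite mul0r; nra.
have q0 : 0 < qcoef r by rewrite /qcoef divr_gt0//; lra.
rewrite -ler_norml -(@ler_pXn2r _ 2)// ?nnegrE// expr1n.
rewrite real_normK ?num_real// /vartheta_arg exprMn sqr_sqrtr; last first.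
  by rewrite -mulrN -invrN divr_ge0// oppr_ge0 ltW.
have pn0 : pcoef r != 0 by rewrite lt_eqF.
rewrite (_ : _ ^+ 2 * _ = (27 * qcoef r ^+ 2) / (4 * (- pcoef r) ^+ 3)); last first.
  by field.
rewrite ler_pdivrMr ?mul1r; last by rewrite mulr_gt0// exprn_gt0// oppr_gt0.
rewrite -subr_ge0.
rewrite (_ : _ - _ = (4 * (3 + 4 * r - 2 * r ^+ 2) ^+ 3
    - 324 * r ^+ 4 * (2 * r - 1) ^+ 2) / (12 ^+ 3 * r ^+ 6)); last first.
  by rewrite /pcoef /qcoef; field; rewrite gt_eqF.
rewrite divr_ge0//; last by rewrite mulr_ge0// exprn_ge0// ltW.
rewrite subr_ge0.
have A : 9 / 2 <= 3 + 4 * r - 2 * r ^+ 2 by nra.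
have A0 : 0 <= 3 + 4 * r - 2 * r ^+ 2 by apply: le_trans A; lra.
have A3 : (9 / 2) ^+ 3 <= (3 + 4 * r - 2 * r ^+ 2) ^+ 3.
  by apply: lerXn2r; rewrite ?nnegrE.
have B1 : r ^+ 4 <= 1 by rewrite exprn_ile1// ltW.
have t0 : 0 <= 2 * r - 1 by lra.
have t1 : 2 * r - 1 <= 1 by lra.
have B2 : (2 * r - 1) ^+ 2 <= 1 by rewrite exprn_ile1.
have B : r ^+ 4 * (2 * r - 1) ^+ 2 <= 1.
  by rewrite mulr_ile1// exprn_ge0// ltW.
rewrite -mulrA; apply: (@le_trans _ _ (324 * 1)); first by rewrite ler_wpM2l.
apply: (@le_trans _ _ (4 * (9 / 2) ^+ 3)); first by lra.
by rewrite ler_wpM2l.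
Qed.

End well_defined.

(* Main.v *)
Require Import Defs.
From mathcomp Require Import all_boot all_order all_algebra.
From mathcomp Require Import ring lra.
From mathcomp Require Import all_classical all_reals all_analysis.

Import Order.TTheory GRing.Theory Num.Theory.
Import numFieldNormedType.Exports.

Local Open Scope classical_set_scope.
Local Open Scope ring_scope.

(* By homogeneity and the symmetry x <-> y it suffices to maximise the convex
   function |grad P(1, r)|^2 of the coefficients (a, b, c) over the unit ball.
   If b (a + c) >= 0, the quarter disc contained in the octagon bounds the
   symmetric matrix of P in operator norm, so |grad P(1, r)|^2 / 4 <= 1 + r^2
   <= H(r, 1). Otherwise, changing the sign of P and swapping a and c (which does
   not decrease the gradient when it makes |a| the larger one), we may assume
   a <= c <= -a and b >= 0. Raising b until the form touches 1 on the octagon,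
   at a point of direction (u, 1), writes it as a mixture of (1/2, 1, 1/2) and
   (-1, 1 + 3u, (1 - 3u^2)/2) when u >= tau, and otherwise as a mixture of
   forms touching the side y = 1. By convexity everything reduces to the
   maximum of H(r, u) over tau <= u <= 1. Since dH/du = (3/2) d_r, and since
   d_r(u) / (u - omega) is a convex quadratic in u, negative at 0 and
   nonpositive at 1, this maximum is attained at omega. *)

(** * The constant [tau] and sign estimates for the cubic *)

Section omega_theory.
Set Implicit Arguments.
Unset Strict Implicit.
Context {R : realType}.
Implicit Types r s t u : R.

Lemma sqrt2E : Num.sqrt 2 = 1 + tau :> R.
Proof. by rewrite /tau addrC subrK. Qed.

Lemma tau_sqr : tau ^+ 2 = 1 - 2 * tau :> R.
Proof.
have : (1 + tau) ^+ 2 = 2 :> R by rewrite -sqrt2E sqr_sqrtr.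
by nra.
Qed.

Lemma tau_bounds : (2 / 5 : R) < tau < (1 / 2 : R).
Proof.
have t0 : 0 <= 1 + tau :> R by rewrite -sqrt2E sqrtr_ge0.
have := tau_sqr; move: (tau : R) t0 => t t0 ht.
by apply/andP; split; nra.
Qed.

Lemma dcubic_ge0 r u : 0 <= r <= 1 / 2 -> 0 <= u <= 1 -> 0 <= dcubic r u.
Proof.
move=> /andP[r0 r1] /andP[u0 u1].
(* Expansion in powers of [1 / 2 - r], with coefficients that are nonnegative for [u] in
   [[0, 1]]. *)
have -> : dcubic r u = 3 / 4 * (1 - u) * (1 + 4 * u - 2 * u ^+ 2)
   + (1 / 2 - r) * u * (1 + 9 * u - 6 * u ^+ 2)
   + (1 / 2 - r) ^+ 2 * (6 * u ^+ 3 + u + 1).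
  by rewrite /dcubic; field.
have u3 : 0 <= u ^+ 3 by rewrite exprn_ge0.
have uu : u ^+ 2 <= u by rewrite expr2 ler_piMr.
have u2 : 0 <= u ^+ 2 by rewrite sqr_ge0.
apply: addr_ge0; first apply: addr_ge0.
- by apply: mulr_ge0; [apply: mulr_ge0|]; lra.
- by apply: mulr_ge0; [apply: mulr_ge0|]; lra.
- by apply: mulr_ge0; [exact: sqr_ge0|lra].
Qed.

Lemma dcubic_gt0 r u : 0 <= u <= 1 / 2 -> 0 < dcubic r u.
Proof.
move=> /andP[u0 u1].
(* As a quadratic in [r], the cubic is [A * r ^+ 2 - B * r + (3 * u + 1)]; completing the square
   shows that its discriminant is negative. *)
pose A := 6 * u ^+ 3 + u + 1; pose B := 9 * u ^+ 2 + 2 * u + 1.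
have A0 : 0 < A by rewrite /A; have := exprn_ge0 3 u0; lra.
rewrite -(pmulr_rgt0 _ (mulr_gt0 (ltr0n R 4) A0)).
have -> : 4 * A * dcubic r u = (2 * A * r - B) ^+ 2
    + (3 + u * (12 - 10 * u - 12 * u ^+ 2 - 9 * u ^+ 3)).
  by rewrite /A /B /dcubic; ring.
have u2 : u ^+ 2 <= u by rewrite expr2 ler_piMr//; lra.
have u3 : u ^+ 3 <= u by rewrite exprS ler_piMr//; lra.
have := sqr_ge0 (2 * A * r - B).
suff : 0 <= u * (12 - 10 * u - 12 * u ^+ 2 - 9 * u ^+ 3) + 2 by lra.
nra.
Qed.

Lemma dcubic1 r : dcubic r 1 = 4 * (2 * r - 1) * (r - 1).
Proof. by rewrite /dcubic; ring. Qed.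

(* Simpson's rule is exact on cubics, and [dcubic r] is [2 / 3] times the
   derivative of [Hfun r]. *)
Lemma Hfun_diff r u v : Hfun r v - Hfun r u =
  (v - u) * (dcubic r u + 4 * dcubic r ((u + v) / 2) + dcubic r v) / 4.
Proof. by rewrite /Hfun /dcubic; field. Qed.

Definition dcubic_deriv r u :=
  18 * r ^+ 2 * u ^+ 2 - 18 * r * u + (r ^+ 2 - 2 * r + 3).

(** Divided difference of the cubic at [u] and [w]; for [w = omega r] it is the cofactor of the
    root. *)
Definition dcubic_quo r w u := 6 * r ^+ 2 * (u ^+ 2 + u * w + w ^+ 2)
  - 9 * r * (u + w) + (r ^+ 2 - 2 * r + 3).

Lemma dcubic_diff r u w : dcubic r u - dcubic r w = (u - w) * dcubic_quo r w u.
Proof. by rewrite /dcubic /dcubic_quo; ring. Qed.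

(** * The trigonometric root of the cubic and its location *)

Lemma omegaE r : 1 / 2 < r -> omega r =
  1 / (2 * r) + 2 * Num.sqrt (- (pcoef r / 3)) * cos (vartheta r - 2 * pi / 3).
Proof. by move=> r0; rewrite /omega leNgt r0. Qed.

Lemma pcoef_lt0 r : 1 / 2 < r <= 1 -> pcoef r < 0.
Proof.
move=> /andP[r0 r1]; have rp : 0 < r by lra.
rewrite /pcoef ltr_pdivrMr; last by rewrite mulr_gt0// exprn_gt0.
by rewrite mul0r; nra.
Qed.

Lemma cos_triple (x : R) : cos (3 * x) = 4 * cos x ^+ 3 - 3 * cos x.
Proof.
rewrite (_ : 3 * x = x + x + x); last by ring.
rewrite !cosD sinD.
have := cos2Dsin2 x; move: (cos x) (sin x) => c s h.
have -> : (c * c - s * s) * c - (s * c + c * s) * s = c ^+ 3 - 3 * c * s ^+ 2 by ring.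
have -> : s ^+ 2 = 1 - c ^+ 2 by rewrite -h; ring.
by ring.
Qed.

(** Viète's solution: the shift by [1 / (2 * r)] gives the depressed cubic
    [v ^+ 3 + pcoef r * v + qcoef r], and the offset [2 * pi / 3] becomes a full period when the
    angle is tripled. *)
Lemma dcubic_omega r : 1 / 2 < r <= 1 -> dcubic r (omega r) = 0.
Proof.
move=> hr; have /andP[r0 r1] := hr; have rp : r != 0 by rewrite gt_eqF//; lra.
rewrite omegaE//; set x := vartheta r - _; set S := Num.sqrt _.
have p0 := pcoef_lt0 hr; have pn0 : pcoef r != 0 by rewrite lt_eqF.
have S2 : S ^+ 2 = - (pcoef r / 3).
  by rewrite sqr_sqrtr// oppr_ge0 ler_pdivrMr// mul0r ltW.
have hc : 4 * cos x ^+ 3 - 3 * cos x = vartheta_arg r.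
  rewrite -cos_triple /x /vartheta.
  rewrite (_ : 3 * _ = acos (vartheta_arg r) - pi *+ 2); last by rewrite -mulr_natl; field.
  rewrite -cosD2pi subrK acosK//.
  by rewrite in_itv/=; exact: vartheta_arg_bounded.
have hA : S * vartheta_arg r = 3 * qcoef r / (2 * pcoef r).
  rewrite /vartheta_arg mulrCA -[RHS]mulr1; congr (_ * _).
  rewrite /S -sqrtrM; last by rewrite oppr_ge0 ler_pdivrMr// mul0r ltW.
  by rewrite (_ : _ * _ = 1) ?sqrtr1//; field.
have -> : dcubic r (1 / (2 * r) + 2 * S * cos x) =
    6 * r ^+ 2 * ((2 * S * cos x) ^+ 3 + pcoef r * (2 * S * cos x) + qcoef r).
  by rewrite /dcubic /pcoef /qcoef; field.
suff -> : (2 * S * cos x) ^+ 3 + pcoef r * (2 * S * cos x) = - qcoef r.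
  by rewrite addNr mulr0.
have -> : (2 * S * cos x) ^+ 3 + pcoef r * (2 * S * cos x) =
    2 * S * (4 * S ^+ 2 * cos x ^+ 3 + pcoef r * cos x) by ring.
rewrite S2.
have -> : 2 * S * (4 * (- (pcoef r / 3)) * cos x ^+ 3 + pcoef r * cos x) =
  - (2 / 3) * pcoef r * (S * (4 * cos x ^+ 3 - 3 * cos x)) by field.
by rewrite hc hA; field.
Qed.


(** Tripling the angle makes the value [c] a root of [(c + 1) * (2 * c - 1) ^+ 2], and monotonicity
    of the cosine rules out [-1]. *)
Lemma cos_pi_div3 : cos (pi / 3) = 1 / 2 :> R.
Proof.
have pi0 := pi_gt0 R.
have : cos (3 * (pi / 3)) = -1 :> R by rewrite mulrCA divff// mulr1 cospi.
rewrite cos_triple; set c := cos _ => h.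
have c1 : c != -1.
  suff : -1 < c by move=> c1; rewrite gt_eqF.
  by rewrite -cospi ltr_cos ?in_itv/=; [lra|apply/andP; split; lra..].
have : (c + 1) * (2 * c - 1) ^+ 2 = 0.
  rewrite (_ : _ * _ = (4 * c ^+ 3 - 3 * c) + 1); last by ring.
  by rewrite h addNr.
move/eqP; rewrite mulf_eq0 addr_eq0 (negbTE c1) sqrf_eq0/= subr_eq0 => /eqP h2.
by lra.
Qed.

Lemma cos_middle_third (x : R) : pi / 3 <= x <= 2 * pi / 3 ->
  cos x ^+ 2 <= 1 / 4.
Proof.
move=> /andP[x0 x1]; have pi0 := pi_gt0 R.
have I (s : R) : 0 <= s -> s <= pi -> s \in `[0, pi] by rewrite in_itv/= => -> ->.
have c1 : cos x <= 1 / 2.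
  by rewrite -cos_pi_div3 leNgt ltr_cos -?leNgt//; apply: I; lra.
have c2 : - (1 / 2) <= cos x.
  rewrite -cos_pi_div3 -(cosN (pi / 3)) -cosDpi leNgt ltr_cos -?leNgt; [|apply: I; lra..].
  by lra.
by nra.
Qed.

(** This identifies the middle root: with [x] the angle in [omega r], the derivative is a positive
    multiple of [pcoef r * (1 - 4 * cos x ^+ 2)], where [pcoef r < 0]. *)
Lemma dcubic_deriv_omega r : 1 / 2 < r <= 1 -> dcubic_deriv r (omega r) <= 0.
Proof.
move=> hr; have /andP[r0 r1] := hr; have rp : r != 0 by rewrite gt_eqF//; lra.
rewrite omegaE//; set x := vartheta r - _; set S := Num.sqrt _.
have p0 := pcoef_lt0 hr.
have S2 : S ^+ 2 = - (pcoef r / 3).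
  by rewrite sqr_sqrtr// oppr_ge0 ler_pdivrMr// mul0r ltW.
have -> : dcubic_deriv r (1 / (2 * r) + 2 * S * cos x) =
    6 * r ^+ 2 * (3 * (4 * S ^+ 2 * cos x ^+ 2) + pcoef r).
  by rewrite /dcubic_deriv /pcoef; field.
rewrite S2.
have hx : cos x ^+ 2 <= 1 / 4.
  have := acos_ge0 (vartheta_arg_bounded hr).
  have := acos_lepi (vartheta_arg_bounded hr).
  (* Since [vartheta r] lies in [[0, pi / 3]], the angle [- x] lies in the middle third of
     [[0, pi]]. *)
  rewrite -cosN => h1 h2; apply: cos_middle_third.
  by rewrite /x /vartheta; apply/andP; split; lra.
apply: mulr_ge0_le0; first by rewrite mulr_ge0// sqr_ge0.
by nra.
Qed.

(** The cubic vanishes at [omega r] with nonpositive slope. But it is positive on [[0, tau]], its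
    slope is positive at negative arguments, and a root [w >= 1] would force
    [dcubic r w <= dcubic r 1 < 0]. *)
Lemma omega_bounds r : 1 / 2 < r <= 1 -> tau < omega r < 1.
Proof.
move=> hr; have /andP[r0 r1] := hr.
have := dcubic_deriv_omega hr; have := dcubic_omega hr.
move: (omega r) => w dw ddw; have /andP[t0 t1] := tau_bounds.
apply/andP; split.
  rewrite ltNge; apply/negP => wt.
  have [w0|w0] := leP 0 w.
    have : 0 < dcubic r w by apply: dcubic_gt0; apply/andP; split; lra.
    by rewrite dw ltxx.
  suff : 0 < dcubic_deriv r w by lra.
  have rw : r * w < 0 by rewrite pmulr_rlt0//; lra.
  have := sqr_ge0 (r * w); have := sqr_ge0 (r - 1).
  by rewrite /dcubic_deriv; nra.
rewrite ltNge; apply/negP => w1.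
(* the derivative is convex in [u], so it would be nonpositive between [1] and [w] *)
have dd1 : dcubic_deriv r 1 <= 0.
  suff : 18 * r * w * (r * w - 1) >= 18 * r * (r - 1) by move: ddw; rewrite /dcubic_deriv; lra.
  have : 0 <= r * (w - 1) * (r * (w + 1) - 1) by apply: mulr_ge0; nra.
  by lra.
have hr1 : r < 1.
  by rewrite lt_neqAle r1 andbT; apply/eqP => r1'; move: dd1; rewrite /dcubic_deriv r1'; lra.
have d1 : dcubic r 1 < 0 by rewrite dcubic1; nra.
(* Trapezoidal rule for the derivative, with its exact error term. *)
have : dcubic r w - dcubic r 1 = (w - 1) *
   ((dcubic_deriv r 1 + dcubic_deriv r w) / 2 - 3 * (r * (w - 1)) ^+ 2).
  by rewrite /dcubic /dcubic_deriv; field.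
rewrite dw sub0r => h.
suff : - dcubic r 1 <= 0 by lra.
rewrite h; apply: mulr_ge0_le0; first by lra.
by have := sqr_ge0 (r * (w - 1)); lra.
Qed.

(** The endpoint signs come from [dcubic r 0 > 0] and [dcubic r 1 <= 0]. For [r = 1] the quotient
    vanishes at [u = 1], hence the strict bound on [u]. *)
Lemma dcubic_quo_lt0 r u : 1 / 2 < r <= 1 -> 0 <= u < 1 ->
  dcubic_quo r (omega r) u < 0.
Proof.
move=> hr /andP[u0 u1]; have /andP[r0 r1] := hr.
have /andP[w0 w1] := omega_bounds hr; have /andP[t0 _] := tau_bounds.
have dw := dcubic_omega hr; move: (omega r) w0 w1 dw => w w0 w1 dw.
have g0 : dcubic_quo r w 0 < 0.
  have := dcubic_diff r 0 w; rewrite dw subr0 => h.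
  have : 0 < dcubic r 0 by rewrite /dcubic; nra.
  by rewrite h sub0r mulNr oppr_gt0 pmulr_rlt0//; lra.
have g1 : dcubic_quo r w 1 <= 0.
  have := dcubic_diff r 1 w; rewrite dw subr0 dcubic1 => h.
  have : (1 - w) * dcubic_quo r w 1 <= 0 by rewrite -h; nra.
  by rewrite pmulr_rle0//; lra.
have -> : dcubic_quo r w u = (1 - u) * dcubic_quo r w 0 + u * dcubic_quo r w 1
    - 6 * r ^+ 2 * (u * (1 - u)).
  by rewrite /dcubic_quo; ring.
have uu : 0 <= 6 * r ^+ 2 * (u * (1 - u)).
  by apply: mulr_ge0; [rewrite mulr_ge0// sqr_ge0|apply: mulr_ge0; lra].
have : (1 - u) * dcubic_quo r w 0 < 0 by rewrite pmulr_rlt0//; lra.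
have : u * dcubic_quo r w 1 <= 0 by rewrite mulr_ge0_le0.
by lra.
Qed.

Lemma dcubic_omega_uniq r u : 1 / 2 < r <= 1 -> tau < u < 1 ->
  dcubic r u = 0 -> u = omega r.
Proof.
move=> hr /andP[u0 u1] du; have /andP[t0 _] := tau_bounds.
have := dcubic_diff r u (omega r); rewrite du dcubic_omega// subr0.
move/esym/eqP; rewrite mulf_eq0 subr_eq0 => /orP[/eqP//|].
by rewrite lt_eqF//; apply: dcubic_quo_lt0 => //; apply/andP; split; lra.
Qed.

Lemma omega_itv r : r <= 1 -> tau <= omega r <= 1.
Proof.
move=> r1; have /andP[_ t1] := tau_bounds.
have [r2|r2] := leP r (1 / 2).
  by rewrite /omega r2 lexx andbT; lra.
have /andP[h1 h2] := omega_bounds (introT andP (conj r2 r1)).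
by rewrite !ltW.
Qed.

(** * Maximum of [Hfun r] over [[tau, 1]] *)

Lemma Hfun_le_omega r u : 0 <= r <= 1 -> tau <= u <= 1 ->
  Hfun r u <= Hfun r (omega r).
Proof.
move=> /andP[r0 r1] /andP[u0 u1]; have /andP[t0 t1] := tau_bounds.
rewrite -subr_ge0 Hfun_diff; apply: divr_ge0 => //.
have [r2|r2] := leP r (1 / 2).
  rewrite /omega r2; apply: mulr_ge0; first by lra.
  have D s : 0 <= s <= 1 -> 0 <= dcubic r s by apply: dcubic_ge0; apply/andP.
  have := D u; have := D ((u + 1) / 2); have := D 1.
  move=> h1 h2 h3.
  have {}h1 : 0 <= dcubic r 1 by apply: h1; apply/andP; split; lra.
  have {}h2 : 0 <= dcubic r ((u + 1) / 2) by apply: h2; apply/andP; split; lra.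
  have {}h3 : 0 <= dcubic r u by apply: h3; apply/andP; split; lra.
  by lra.
have hr : 1 / 2 < r <= 1 by apply/andP.
have /andP[w0 w1] := omega_bounds hr.
(* This controls the signs of the Simpson samples at [u] and at the midpoint; the sample at
   [omega r] vanishes. *)
have S s : 0 <= s <= 1 -> (s - omega r) * dcubic r s <= 0.
  move=> /andP[s0 s1].
  have -> : dcubic r s = (s - omega r) * dcubic_quo r (omega r) s.
    by rewrite -dcubic_diff dcubic_omega// subr0.
  rewrite mulrA -expr2; apply: mulr_ge0_le0; first exact: sqr_ge0.
  have [s1'|s1'] := ltP s 1; first by apply/ltW/dcubic_quo_lt0 => //; apply/andP.
  have -> : s = 1 by apply/le_anti/andP.
  have := dcubic_diff r 1 (omega r); rewrite dcubic_omega// subr0 dcubic1 => h.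
  have : (1 - omega r) * dcubic_quo r (omega r) 1 <= 0 by rewrite -h; nra.
  by rewrite pmulr_rle0//; lra.
rewrite dcubic_omega// addr0.
have := S u; have := S ((u + omega r) / 2); move: (omega r) w0 w1 {S} => w w0 w1 h1 h2.
have {}h1 : ((u + w) / 2 - w) * dcubic r ((u + w) / 2) <= 0 by apply: h1; apply/andP; split; lra.
have {}h2 : (u - w) * dcubic r u <= 0 by apply: h2; apply/andP; split; lra.
by lra.
Qed.

End omega_theory.

(** * Symmetries of the unit ball and constraints from boundary points *)

Section unit_ball.
Context {R : realType}.
Set Implicit Arguments.
Unset Strict Implicit.
Implicit Types a b c r t u x y K : R.

(** Pointwise form of the unit ball, avoiding the supremum; [qoct_normP] relates it to
    [qoct_norm]. *)
Definition oct_ball a b c :=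
  forall z, quarter_octagon z -> `|qform a b c z| <= 1.

(* [‖∇P(1, r)‖² / 4] for [P = qform a b c] *)
Definition half_grad_sqr r a b c :=
  (a + b * r / 2) ^+ 2 + (b / 2 + c * r) ^+ 2.

Lemma quarter_octagon_swap x y :
  quarter_octagon (x, y) -> quarter_octagon (y, x).
Proof. by case=> /= x01 y01 xy; split => //=; rewrite addrC. Qed.

Lemma qform_swap a b c x y : qform a b c (x, y) = qform c b a (y, x).
Proof. by rewrite /qform /=; ring. Qed.

Lemma qform_opp a b c : qform (- a) (- b) (- c) = - qform a b c.
Proof. by apply/funext => z; rewrite /qform !fctE; ring. Qed.

Lemma oct_ball_swap a b c : oct_ball a b c -> oct_ball c b a.
Proof.
by move=> h [x y] /quarter_octagon_swap/h; rewrite -qform_swap.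
Qed.

Lemma oct_ball_opp a b c : oct_ball a b c -> oct_ball (- a) (- b) (- c).
Proof. by move=> h z /h; rewrite qform_opp normrN. Qed.

Lemma half_grad_sqr_opp r a b c :
  half_grad_sqr r (- a) (- b) (- c) = half_grad_sqr r a b c.
Proof. by rewrite /half_grad_sqr; field. Qed.

Lemma oct_ball_side a b c t : oct_ball a b c -> 0 <= t <= tau ->
  `|a * t ^+ 2 + b * t + c| <= 1.
Proof.
move=> h /andP[t0 t1]; have /andP[_ t2] := @tau_bounds R.
have /h : quarter_octagon (t, 1).
  split=> /=; [apply/andP; split; lra|apply/andP; split; lra|].
  by rewrite sqrt2E; lra.
by rewrite /qform /= expr1n !mulr1.
Qed.

Lemma oct_ball_coef a b c : oct_ball a b c -> `|a| <= 1 /\ `|c| <= 1.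
Proof.
move=> h; have /andP[t0 _] := @tau_bounds R.
have I0 : 0 <= (0 : R) <= tau by apply/andP; split; lra.
have := oct_ball_side h I0; have := oct_ball_side (oct_ball_swap h) I0.
by rewrite expr0n/= !mulr0 !add0r.
Qed.

(** By homogeneity it suffices to evaluate at the point [(s * u, s)] of the oblique side; [tau <= u]
    ensures [s <= 1]. *)
Lemma oct_ball_diag a b c u : oct_ball a b c -> tau <= u <= 1 ->
  a * u ^+ 2 + b * u + c <= (1 + u) ^+ 2 / 2.
Proof.
move=> h /andP[u0 u1]; have /andP[t0 _] := @tau_bounds R.
have u10 : 0 < 1 + u by lra.
pose s : R := Num.sqrt 2 / (1 + u).
have s0 : 0 <= s by rewrite divr_ge0 ?sqrtr_ge0 ?ltW.
have s1 : s <= 1 by rewrite ler_pdivrMr// mul1r sqrt2E; lra.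
have s2 : s ^+ 2 * (1 + u) ^+ 2 = 2.
  by rewrite -exprMn /s divfK ?gt_eqF// sqr_sqrtr.
have /h : quarter_octagon (s * u, s).
  split=> /=.
  - have u00 : 0 <= u by lra.
    by rewrite mulr_ge0// mulr_ile1.
  - by rewrite s0 s1.
  - by rewrite /s -[X in _ + X]mulr1 -mulrDr [u + 1]addrC divfK// gt_eqF.
have -> : qform a b c (s * u, s) = s ^+ 2 * (a * u ^+ 2 + b * u + c).
  by rewrite /qform /=; ring.
move=> /ler_normlW h1.
rewrite ler_pdivlMr// mulrC -s2 -mulrA [(1 + u) ^+ 2 * _]mulrC mulrA.
by rewrite ler_piMl// sqr_ge0.
Qed.

(* The quarter disc lies in the octagon, and the symmetric matrix of the form
   then has operator norm at most 1. *)
Lemma half_grad_sqr_disc r a b c : 0 <= r -> oct_ball a b c ->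
  0 <= b * (a + c) -> half_grad_sqr r a b c <= 1 + r ^+ 2.
Proof.
wlog : a b c / 0 <= b /\ 0 <= a + c.
  move=> wl r0 h; rewrite (_ : b * (a + c) = (- b) * (- a - c)); last by ring.
  have [b0|b0] := leP 0 b; have [ac|ac] := leP 0 (a + c) => hs.
  - by apply: wl => //; rewrite -mulrNN opprD.
  - have b00 : b = 0 by nra.
    rewrite -half_grad_sqr_opp; apply: (wl _ _ _ _ r0 (oct_ball_opp h)).
      by rewrite b00; split; lra.
    by rewrite b00 oppr0 mul0r.
  - have ac0 : a + c = 0 by nra.
    rewrite -half_grad_sqr_opp; apply: (wl _ _ _ _ r0 (oct_ball_opp h)).
      by split; lra.
    by rewrite -opprD ac0 oppr0 mulr0.
  - rewrite -half_grad_sqr_opp; apply: (wl _ _ _ _ r0 (oct_ball_opp h)) => //.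
    by split; lra.
move=> [b0 ac0] r0 h _.
(* The symmetric matrix of the form has eigenvalues [A + D] and [A - D]. *)
pose A := (a + c) / 2; pose B := (a - c) / 2; pose C := b / 2.
pose D := Num.sqrt (B ^+ 2 + C ^+ 2).
have A0 : 0 <= A by rewrite /A; lra.
have C0 : 0 <= C by rewrite /C; lra.
have D0 : 0 <= D by exact: sqrtr_ge0.
have D2 : D ^+ 2 = B ^+ 2 + C ^+ 2 by rewrite sqr_sqrtr// addr_ge0 ?sqr_ge0.
have aE : a = A + B by rewrite /A /B; field.
have cE : c = A - B by rewrite /A /B; field.
have bE : b = 2 * C by rewrite /C; field.
clearbody D A B C.
have AD1 : A + D <= 1.
  have [D00|Dn0] := eqVneq D 0.
    have B00 : B = 0 by have := sqr_ge0 C; have := sqr_ge0 B; nra.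
    have [/ler_normlW] := oct_ball_coef h.
    by rewrite aE D00 B00.
  have Dp : 0 < D by rewrite lt_neqAle eq_sym Dn0.
  pose q := B / D.
  have q2 : q ^+ 2 + (C / D) ^+ 2 = 1.
    by rewrite /q !exprMn -mulrDl -D2 exprVn divff// expf_neq0.
  have CD0 : 0 <= C / D by rewrite divr_ge0.
  have /andP[q0 q1] : -1 <= q <= 1 by apply/andP; split; nra.
  (* Half-angle formulas for the unit eigenvector of [A + D]; [C >= 0] lets it lie in the first
     quadrant. *)
  pose xi := Num.sqrt ((1 + q) / 2); pose et := Num.sqrt ((1 - q) / 2).
  have xi2 : xi ^+ 2 = (1 + q) / 2 by rewrite sqr_sqrtr//; lra.
  have et2 : et ^+ 2 = (1 - q) / 2 by rewrite sqr_sqrtr//; lra.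
  have xi0 : 0 <= xi by exact: sqrtr_ge0.
  have et0 : 0 <= et by exact: sqrtr_ge0.
  have xe : 2 * xi * et = C / D.
    apply/eqP; rewrite -(@eqrXn2 _ 2)//; last by rewrite !mulr_ge0.
    by rewrite !exprMn xi2 et2 -exprMn; move: q2; lra.
  have /h : quarter_octagon (xi, et).
    split=> /=; [apply/andP; split => //; nra|apply/andP; split => //; nra|].
    rewrite -[xi + et]ger0_norm ?addr_ge0// -sqrtr_sqr ler_sqrt//.
    have := sqr_ge0 (xi - et); nra.
  move=> /ler_normlW; rewrite /qform /= xi2 et2 bE -mulrA.
  rewrite (_ : 2 * C * (xi * et) = C * (C / D)); last by rewrite -xe; ring.
  suff -> : a * ((1 + q) / 2) + C * (C / D) + c * ((1 - q) / 2) = A + D by [].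
  rewrite aE cE /q.
  rewrite (_ : _ + _ = A + (B ^+ 2 + C ^+ 2) / D); last by field.
  by rewrite -D2; field.
(* Cauchy-Schwarz for [(B, C)] and [(1 - r ^+ 2, 2 * r)]; the latter has Euclidean norm
   [1 + r ^+ 2]. *)
have cs : B * (1 - r ^+ 2) + 2 * C * r <= D * (1 + r ^+ 2).
  apply: le_trans (ler_norm _) _.
  rewrite -(@ler_pXn2r _ 2)// ?nnegrE//; last first.
    by rewrite mulr_ge0// addr_ge0// sqr_ge0.
  rewrite real_normK ?num_real// exprMn D2 -subr_ge0.
  rewrite (_ : _ - _ = (C * (1 - r ^+ 2) - 2 * B * r) ^+ 2); last by ring.
  exact: sqr_ge0.
have -> : half_grad_sqr r a b c = (A ^+ 2 + D ^+ 2) * (1 + r ^+ 2)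
    + 2 * A * (B * (1 - r ^+ 2) + 2 * C * r).
  by rewrite /half_grad_sqr D2 aE bE cE; field.
have AD2 : (A + D) ^+ 2 <= 1 by rewrite exprn_ile1// addr_ge0.
apply: (@le_trans _ _ ((A + D) ^+ 2 * (1 + r ^+ 2))).
  have : 2 * A * (B * (1 - r ^+ 2) + 2 * C * r) <= 2 * A * (D * (1 + r ^+ 2)).
    by apply: ler_wpM2l => //; lra.
  by lra.
by rewrite ler_piMl// addr_ge0// sqr_ge0.
Qed.


(** * Convexity and mixtures of extremal forms *)

Lemma half_grad_sqr_convex r K l a b c a' b' c' : 0 <= l <= 1 ->
  half_grad_sqr r a b c <= K -> half_grad_sqr r a' b' c' <= K ->
  half_grad_sqr r ((1 - l) * a + l * a') ((1 - l) * b + l * b')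
    ((1 - l) * c + l * c') <= K.
Proof.
move=> /andP[l0 l1] h h'.
have -> : half_grad_sqr r ((1 - l) * a + l * a') ((1 - l) * b + l * b')
    ((1 - l) * c + l * c') = (1 - l) * half_grad_sqr r a b c
      + l * half_grad_sqr r a' b' c'
      - l * (1 - l) * half_grad_sqr r (a - a') (b - b') (c - c').
  by rewrite /half_grad_sqr; field.
have l1' : 0 <= 1 - l by lra.
have n0 : 0 <= half_grad_sqr r (a - a') (b - b') (c - c').
  by rewrite addr_ge0 ?sqr_ge0.
have := mulr_ge0 (mulr_ge0 l0 l1') n0.
have := ler_wpM2l l0 h'; have := ler_wpM2l l1' h; lra.
Qed.

(** Allows [b] to be raised to an upper bound [b'], by convexity on the segment from [0] to [b']. *)
Lemma half_grad_sqr_le_mid r K a b b' c : 0 <= b <= b' ->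
  half_grad_sqr r a 0 c <= K -> half_grad_sqr r a b' c <= K ->
  half_grad_sqr r a b c <= K.
Proof.
move=> /andP[b0 bb] h0 h1.
have [b'0|b'0] := eqVneq b' 0.
  by have -> : b = 0 by lra.
have b'p : 0 < b' by rewrite lt_neqAle eq_sym b'0 (le_trans b0).
have l01 : 0 <= b / b' <= 1.
  by rewrite divr_ge0 ?(ltW b'p)//= ler_pdivrMr// mul1r.
have := half_grad_sqr_convex l01 h0 h1.
by rewrite mulr0 add0r divfK// -!mulrDl subrK !mul1r.
Qed.

Lemma Hfun1 r : Hfun r 1 = 1 + r ^+ 2 + 4 * (1 - r) ^+ 2.
Proof. by rewrite /Hfun; field. Qed.

Lemma half_grad_sqr_extremal r u :
  half_grad_sqr r (- 1) (1 + 3 * u) ((1 - 3 * u ^+ 2) / 2) = Hfun r u.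
Proof. by rewrite /half_grad_sqr /Hfun; field. Qed.

(* The extreme points of the unit ball that touch the side [y = 1]. *)
Lemma half_grad_sqr_side_extremal r t : 0 <= r <= 1 -> 0 <= t <= 1 ->
  half_grad_sqr r (- 1) (2 * t) (1 - t ^+ 2) <= Hfun r 1.
Proof.
move=> /andP[r0 r1] /andP[t0 t1]; rewrite Hfun1 -subr_ge0.
rewrite (_ : _ - _ = 4 * (1 - r) ^+ 2
    - t ^+ 2 * ((1 - r - t * r) * (1 + r - t * r))); last first.
  by rewrite /half_grad_sqr; field.
have tr0 : 0 <= t * r by exact: mulr_ge0.
have tr1 : t * r <= r by rewrite ler_piMl.
have p0 : 0 <= 1 + r - t * r by lra.
have t20 := sqr_ge0 t.
have [w|w] := leP (1 - r - t * r) 0.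
  have := mulr_ge0_le0 t20 (mulr_le0_ge0 w p0).
  by have := sqr_ge0 (1 - r); lra.
(* For [r >= 1 / 2] this follows from [t * r < 1 - r]; otherwise the right side exceeds 1. *)
have t2 : t ^+ 2 <= 2 * (1 - r).
  have tt : t ^+ 2 <= t by rewrite expr2 ler_piMl.
  have [r2|r2] := leP (1 / 2) r; last by lra.
  nra.
have h : (1 - r - t * r) * (1 + r - t * r) <= (1 - r) * 2.
  by apply: ler_pM; lra.
have h0 : 0 <= (1 - r - t * r) * (1 + r - t * r) by apply: mulr_ge0; lra.
have : t ^+ 2 * ((1 - r - t * r) * (1 + r - t * r)) <= 2 * (1 - r) * ((1 - r) * 2).
  exact: ler_pM.
by lra.
Qed.

(** Three cases, by the boundary point that constrains the form: on the oblique side, on the side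
    [y = 1], or at their common vertex [(tau, 1)]. *)
Lemma half_grad_sqr_ordered r a b c : 0 <= r <= 1 -> oct_ball a b c ->
  0 <= b -> a <= c -> a + c <= 0 ->
  half_grad_sqr r a b c <= Hfun r (omega r).
Proof.
move=> r01 h b0 ac ac0; have /andP[r0 r1] := r01.
have /andP[t0 t1] := @tau_bounds R; have t2 := @tau_sqr R.
set K := Hfun _ _.
have HK u : tau <= u <= 1 -> Hfun r u <= K by exact: Hfun_le_omega.
have HK1 : Hfun r 1 <= K by apply: HK; apply/andP; split; lra.
have K1 : 1 + r ^+ 2 <= K.
  by apply: le_trans HK1; rewrite Hfun1; have := sqr_ge0 (1 - r); lra.
have [ha hc] := oct_ball_coef h.
move: ha hc; rewrite !ler_norml => /andP[a0 a1] /andP[c0 c1].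
have rr0 := sqr_ge0 r.
have M0 : half_grad_sqr r a 0 c <= K.
  apply: le_trans K1; rewrite /half_grad_sqr !mul0r addr0 add0r exprMn.
  have : a ^+ 2 <= 1 by nra.
  have : c ^+ 2 <= 1 by nra.
  by move=> h1 h2; apply: lerD => //; rewrite ler_piMl.
have Kpos : half_grad_sqr r 0 0 1 <= K.
  by apply: le_trans K1; rewrite /half_grad_sqr; lra.
pose k := 1 / 2 - a; have k0 : 0 < k by rewrite /k; lra.
have [ck|ck] := leP (tau ^+ 2 * k) (1 / 2 - c).
  (* Dividing [oct_ball_diag] by its parameter [v] bounds [b] by [1 + k * v + (1 / 2 - c) / v]; the
     minimum over [v], attained at this [u], is [1 + 2 * k * u]. *)
  pose u := Num.sqrt ((1 / 2 - c) / k).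
  have u2 : k * u ^+ 2 = 1 / 2 - c.
    rewrite sqr_sqrtr; last first.
      rewrite divr_ge0 ?(ltW k0)//; apply: le_trans ck.
      by rewrite mulr_ge0 ?sqr_ge0 ?ltW.
    by rewrite mulrC divfK// gt_eqF.
  have u0 : 0 <= u by exact: sqrtr_ge0.
  clearbody u.
  have ut : tau <= u.
    rewrite leNgt; apply/negP => ut.
    have : u ^+ 2 < tau ^+ 2 by nra.
    by rewrite -(ltr_pM2l k0) u2; lra.
  have u1 : u <= 1.
    rewrite leNgt; apply/negP => u1.
    have : 1 < u ^+ 2 by nra.
    by rewrite -(ltr_pM2l k0) u2 /k; lra.
  have tu1 : tau <= u <= 1 by apply/andP.
  have bu : b <= 1 + 2 * k * u.
    have := oct_ball_diag h tu1 => hd.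
    have up : 0 < u by lra.
    rewrite -(ler_pM2r up); have := u2; rewrite /k in hd *.
    by lra.
  apply: (@half_grad_sqr_le_mid r K a b (1 + 2 * k * u) c) => //.
    by rewrite b0.
  (* The weight for which the first coefficients [1 / 2] and [-1] average to [a]. *)
  pose l := 2 * k / 3.
  have l01 : 0 <= l <= 1 by rewrite /l /k; apply/andP; split; lra.
  have e1 : half_grad_sqr r (1 / 2) 1 (1 / 2) <= K.
    apply: le_trans K1; rewrite -subr_ge0.
    rewrite (_ : _ - _ = (1 - r) ^+ 2 / 2); last by rewrite /half_grad_sqr; field.
    by rewrite divr_ge0 ?sqr_ge0.
  have e2 := HK _ tu1; rewrite -half_grad_sqr_extremal in e2.
  have := half_grad_sqr_convex l01 e1 e2.
  rewrite (_ : (1 - l) * (1 / 2) + l * - 1 = a); last by rewrite /l /k; field.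
  rewrite (_ : (1 - l) * 1 + l * (1 + 3 * u) = 1 + 2 * k * u); last first.
    by rewrite /l; field.
  rewrite (_ : (1 - l) * (1 / 2) + l * ((1 - 3 * u ^+ 2) / 2) = c)//.
  by transitivity (1 / 2 - k * u ^+ 2); [rewrite /l; field|rewrite u2; ring].
have cp : 0 < c by move: ck; rewrite t2 /k; nra.
pose al := - a; have alp : 0 < al by rewrite /al; lra.
have al1 : al <= 1 by rewrite /al; lra.
have aE : a = - al by rewrite /al opprK.
have al01 : 0 <= al <= 1 by rewrite (ltW alp).
(* On the side [y = 1] the form peaks at [t = b / (2 * al)], which is at most [tau] in the first
   case. *)
have [bt|bt] := leP b (2 * al * tau).
  pose t := b / (2 * al).
  have bE : b = 2 * al * t by rewrite /t; field; rewrite gt_eqF.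
  have tp : 0 <= t by rewrite divr_ge0// mulr_ge0// ltW.
  have tt : t <= tau by rewrite ler_pdivrMr ?mulr_gt0// mulrC.
  clearbody t al.
  have /(oct_ball_side h)/ler_normlW : 0 <= t <= tau by rewrite tp.
  rewrite aE bE => ht.
  have c2 : c <= 1 - al * t ^+ 2 by lra.
  apply: (@le_trans _ _ (half_grad_sqr r (- al) (2 * al * t) (1 - al * t ^+ 2))).
    rewrite /half_grad_sqr lerD2l.
    have at0 : 0 <= 2 * al * t / 2 by rewrite -bE; lra.
    have cr0 : 0 <= c * r by rewrite mulr_ge0// ltW.
    have cr1 : c * r <= (1 - al * t ^+ 2) * r by rewrite ler_wpM2r.
    by move: (2 * al * t / 2) (c * r) ((1 - _) * r) at0 cr0 cr1 => p q s; nra.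
  have t01 : 0 <= t <= 1 by apply/andP; split; lra.
  have e := le_trans (half_grad_sqr_side_extremal r01 t01) HK1.
  have := half_grad_sqr_convex al01 Kpos e.
  rewrite (_ : (1 - al) * 0 + al * - 1 = - al); last by ring.
  rewrite (_ : (1 - al) * 0 + al * (2 * t) = 2 * al * t); last by ring.
  by rewrite (_ : (1 - al) * 1 + _ = 1 - al * t ^+ 2); last by ring.
(* Only the vertex [(tau, 1)] constrains [b]; the bounding form is affine in
   [al] and [lam], hence a mixture of four explicit forms. *)
clearbody al.
(* Failure of the first case gives [tau <= lam] and failure of the second gives [lam <= 1]; [mu]
   rescales [lam] to [[0, 1]]. *)
pose lam := c + tau ^+ 2 * al.
have hv : b * tau <= 1 - c + al * tau ^+ 2.
  have /(oct_ball_side h)/ler_normlW : 0 <= (tau : R) <= tau.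
    by rewrite lexx andbT; lra.
  by rewrite aE; lra.
have lam0 : tau <= lam by move: ck; rewrite /lam /k aE t2; lra.
have tp : 0 < (tau : R) by lra.
have lam1 : lam <= 1.
  have : 2 * al * tau ^+ 2 <= b * tau by rewrite expr2 mulrA ler_pM2r// ltW.
  by rewrite /lam; lra.
pose mu := (lam - tau) / (1 - tau).
have nt : 0 < 1 - tau :> R by lra.
have mu01 : 0 <= mu <= 1.
  by rewrite /mu divr_ge0/= ?ler_pdivrMr//; lra.
have t21 : (1 + tau) * tau = 1 - tau :> R by rewrite mulrDl mul1r -expr2 t2; ring.
have lamE : lam = tau + mu * (1 - tau) by rewrite /mu divfK ?gt_eqF//; ring.
clearbody mu.
(* The bound on [b] from [hv], rewritten with [(1 + tau) * tau = 1 - tau]. *)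
pose b' := (1 - mu) * (1 + tau) + 2 * al * tau.
have bb' : b <= b'.
  rewrite -(ler_pM2r tp) /b' mulrDl -(mulrA (1 - mu)) t21.
  have : c = tau + mu * (1 - tau) - tau ^+ 2 * al by rewrite -lamE /lam; ring.
  by lra.
apply: (@half_grad_sqr_le_mid r K a b b' c) => //; first by rewrite b0.
have e0 : half_grad_sqr r 0 (1 + tau) tau <= K.
  apply: le_trans K1; rewrite /half_grad_sqr.
  by nra.
have tau01 : 0 <= (tau : R) <= 1 by apply/andP; split; lra.
have e1 := le_trans (half_grad_sqr_side_extremal r01 tau01) HK1.
have tt1 : tau <= (tau : R) <= 1 by rewrite lexx; lra.
have e2 := HK _ tt1; rewrite -half_grad_sqr_extremal in e2.
(* Here [al] weighs first coefficient [-1] against [0], and [mu] interpolates within each pair. *)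
have := half_grad_sqr_convex al01 (half_grad_sqr_convex mu01 e0 Kpos)
  (half_grad_sqr_convex mu01 e2 e1).
set a2 := (X in half_grad_sqr r X _ _); set b2 := (X in half_grad_sqr r _ X _).
set c2 := (X in half_grad_sqr r _ _ X).
have -> : a2 = a by rewrite /a2 aE; ring.
have -> : b2 = b' by rewrite /b2 /b'; ring.
have -> // : c2 = c.
have -> : c = tau + mu * (1 - tau) - tau ^+ 2 * al by rewrite -lamE /lam; ring.
by rewrite /c2 t2; field.
Qed.

Lemma half_grad_sqr_max r a b c : 0 <= r <= 1 -> oct_ball a b c ->
  half_grad_sqr r a b c <= Hfun r (omega r).
Proof.
move=> r01; have /andP[r0 r1] := r01; have /andP[t0 t1] := @tau_bounds R.
wlog b0 : a b c / 0 <= b.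
  move=> wl h; have [b0|b0] := leP 0 b; first exact: wl.
  rewrite -half_grad_sqr_opp; apply: wl; last exact: oct_ball_opp.
  by rewrite oppr_ge0 ltW.
move=> h; have [ac|ac] := leP 0 (a + c).
  apply: le_trans (half_grad_sqr_disc r0 h (mulr_ge0 b0 ac)) _.
  apply: (@le_trans _ _ (Hfun r 1)).
    by rewrite Hfun1; have := sqr_ge0 (1 - r); lra.
  by apply: Hfun_le_omega => //; apply/andP; split; lra.
have [ac'|ac'] := leP a c.
  by apply: half_grad_sqr_ordered => //; exact: ltW.
apply: (@le_trans _ _ (half_grad_sqr r c b a)); last first.
  apply: half_grad_sqr_ordered => //; [exact: oct_ball_swap|exact: ltW|].
  by rewrite addrC ltW.
rewrite -subr_ge0.
rewrite (_ : _ - _ = (a - c) * - (a + c) * ((1 - r) * (1 + r))); last first.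
  by rewrite /half_grad_sqr; field.
by apply: mulr_ge0; apply: mulr_ge0; lra.
Qed.

(** * Extremal forms and passage to the Bernstein function *)

Lemma extremal_oct_ball u : tau <= u <= 1 ->
  oct_ball (- 1) (1 + 3 * u) ((1 - 3 * u ^+ 2) / 2).
Proof.
move=> /andP[u0 u1] [x y] [/= /andP[x0 x1] /andP[y0 y1] xy].
have /andP[t0 t1] := @tau_bounds R.
rewrite ler_norml; apply/andP; split.
  (* Lower bound: every summand after [- 1] is nonnegative, as [u >= tau > 1 / 3]. *)
  have -> : qform (- 1) (1 + 3 * u) ((1 - 3 * u ^+ 2) / 2) (x, y) = - 1 +
      ((1 - (x - y) ^+ 2) + (3 * u - 1) * (x * y)
       + 3 / 2 * (1 - u ^+ 2) * y ^+ 2) by rewrite /qform /=; field.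
  rewrite lerDl.
  apply: addr_ge0; first apply: addr_ge0.
  - rewrite (_ : _ - _ = (1 - (x - y)) * (1 + (x - y))); last by ring.
    by apply: mulr_ge0; lra.
  - by rewrite mulr_ge0// ?mulr_ge0//; lra.
  - have u2 : u ^+ 2 <= 1 by rewrite exprn_ile1//; lra.
    by rewrite mulr_ge0 ?sqr_ge0// mulr_ge0//; lra.
have s2 : (x + y) ^+ 2 <= 2.
  have -> : 2 = (Num.sqrt 2) ^+ 2 :> R by rewrite sqr_sqrtr.
  by rewrite ler_pXn2r// ?nnegrE ?sqrtr_ge0// addr_ge0.
have := sqr_ge0 (x - u * y).
(* Upper bound, with equality on the oblique side where [x = u * y]. *)
have -> : qform (- 1) (1 + 3 * u) ((1 - 3 * u ^+ 2) / 2) (x, y) =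
    (x + y) ^+ 2 / 2 - 3 / 2 * (x - u * y) ^+ 2 by rewrite /qform /=; field.
by lra.
Qed.

Lemma qoct_normP a b c : oct_ball a b c <-> qoct_norm (qform a b c) <= 1.
Proof.
split=> h.
  by apply: ge_sup; [case: (has_sup_qoct_norm a b c)|move=> _ [z Oz <-]; exact: h].
by move=> z Oz; apply: le_trans h; exact: qoct_norm_ub.
Qed.

Lemma qoct_norm_opp (P : R * R -> R) : qoct_norm (- P) = qoct_norm P.
Proof.
rewrite /qoct_norm; congr (sup _); apply/seteqP.
by split=> _ [z Oz <-]; exists z => //; rewrite !fctE normrN.
Qed.

Lemma qoct_norm_swap a b c : qoct_norm (qform a b c) = qoct_norm (qform c b a).
Proof.
rewrite /qoct_norm; congr (sup _); apply/seteqP.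
by split=> _ [[x y] Oz <-]; exists (y, x);
  [exact: quarter_octagon_swap|rewrite -qform_swap|
   exact: quarter_octagon_swap|rewrite -qform_swap].
Qed.

Lemma qoct_norm_extremal u : tau <= u <= 1 ->
  qoct_norm (qform (- 1) (1 + 3 * u) ((1 - 3 * u ^+ 2) / 2)) = 1.
Proof.
move=> hu; apply/le_anti/andP; split.
  exact/qoct_normP/extremal_oct_ball.
have O1 : quarter_octagon ((1 : R), (0 : R)).
  have /andP[t0 _] := @tau_bounds R.
  split=> /=; [by rewrite ler01 lexx|by rewrite ler01 lexx|].
  by rewrite addr0 sqrt2E; lra.
apply: le_trans (qoct_norm_ub _ _ _ O1).
by rewrite /qform /= expr1n expr0n/= !mulr0 !addr0 mulr1 normrN1.
Qed.

Lemma norm2_gradient_qform a b c x y : 0 < x ->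
  norm2 (gradient (qform a b c) (x, y)) =
  2 * x * Num.sqrt (half_grad_sqr (y / x) a b c).
Proof.
move=> x0; rewrite gradient_qform /norm2 /=.
have x20 : 0 <= 2 * x by lra.
rewrite -[2 * x](ger0_norm x20) -sqrtr_sqr -sqrtrM ?sqr_ge0//.
by congr (Num.sqrt _); rewrite /half_grad_sqr; field; rewrite gt_eqF.
Qed.

Lemma norm2_gradient_swap a b c x y :
  norm2 (gradient (qform a b c) (x, y)) = norm2 (gradient (qform c b a) (y, x)).
Proof.
by rewrite !gradient_qform /norm2 /=; congr (Num.sqrt _); ring.
Qed.

Lemma norm2_gradient_opp a b c z :
  norm2 (gradient (- qform a b c) z) = norm2 (gradient (qform a b c) z).
Proof.
by rewrite -qform_opp !gradient_qform /norm2 /=; congr (Num.sqrt _); ring.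
Qed.

Lemma bernstein_eq z v :
  (forall a b c, oct_ball a b c -> norm2 (gradient (qform a b c) z) <= v) ->
  (exists a b c, oct_ball a b c /\ norm2 (gradient (qform a b c) z) = v) ->
  bernstein z = v.
Proof.
move=> hle [a [b [c [h hv]]]]; apply/le_anti/andP; split.
  apply: ge_sup; first by case: (has_sup_bernstein z).
  move=> _ [_ [[a' [b' [c' ->]]] /qoct_normP h'] <-]; exact: hle.
rewrite -hv; apply: ub_le_sup; first by case: (has_sup_bernstein z).
by exists (qform a b c) => //; split; [exists a, b, c|exact/qoct_normP].
Qed.

Lemma bernstein0 : bernstein (0 : R, 0 : R) = 0.
Proof.
have g0 a b c : norm2 (gradient (qform a b c) (0, 0)) = 0.
  by rewrite gradient_qform /norm2 /= !mulr0 addr0 expr0n/= addr0 sqrtr0.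
apply: bernstein_eq => [a b c _|]; first by rewrite g0.
exists 0, 0, 0; split=> // z _.
by rewrite /qform !mul0r !addr0 normr0.
Qed.

Lemma gradient_bound a b c x y : 0 < x -> 0 <= y <= x -> oct_ball a b c ->
  norm2 (gradient (qform a b c) (x, y)) <=
  2 * x * Num.sqrt (Hfun (y / x) (omega (y / x))).
Proof.
move=> x0 /andP[y0 yx] h; rewrite norm2_gradient_qform//.
apply: ler_wpM2l; first by lra.
apply: ler_wsqrtr; apply: half_grad_sqr_max => //.
by rewrite divr_ge0 ?(ltW x0)//= ler_pdivrMr// mul1r.
Qed.

End unit_ball.

Theorem theorem3p7 (R : realType) (x y : R) (hxy : quarter_octagon (x, y)) :
  let m := Num.max x y in
  let r := Num.min x y / m in
  let P := qform (- 1) (1 + 3 * omega r) ((1 - 3 * omega r ^+ 2) / 2) in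
  let Q := qform ((1 - 3 * omega r ^+ 2) / 2) (1 + 3 * omega r) (- 1) in
  [/\ bernstein (0 : R, 0 : R) = 0,
      0 < m ->
        0 <= r <= 1 /\ bernstein (x, y) = 2 * m * Num.sqrt (Hfun r (omega r)),
      forall s : R, 1 / 2 < s <= 1 ->
        [/\ tau < omega s < 1, dcubic s (omega s) = 0 &
            forall u : R, tau < u < 1 -> dcubic s u = 0 -> u = omega s],
      0 < m -> y <= x ->
        [/\ qoct_norm P = 1,
            norm2 (gradient P (x, y)) = bernstein (x, y),
            qoct_norm (- P) = 1 &
            norm2 (gradient (- P) (x, y)) = bernstein (x, y)] &
      0 < m -> x <= y ->
        [/\ qoct_norm Q = 1,
            norm2 (gradient Q (x, y)) = bernstein (x, y),
            qoct_norm (- Q) = 1 &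
            norm2 (gradient (- Q) (x, y)) = bernstein (x, y)]].
Proof.
move=> m r P Q.
have [/andP[x0 x1] /andP[y0 y1] _] := hxy; rewrite /= in x0 x1 y0 y1.
have hr : 0 < m -> 0 <= r <= 1.
  move=> m0; rewrite /r divr_ge0 ?(ltW m0) ?le_min ?x0 ?y0//=.
  by rewrite ler_pdivrMr// mul1r le_max !ge_min !lexx.
have hw : 0 < m -> tau <= omega r <= 1.
  by move=> /hr /andP[_ r1]; exact: omega_itv.
have hP : 0 < m -> y <= x ->
    bernstein (x, y) = 2 * m * Num.sqrt (Hfun r (omega r)) /\
    norm2 (gradient P (x, y)) = bernstein (x, y).
  move=> m0 yx; have w := hw m0; move: m0 w.
  rewrite /P /r /m (max_l yx) (min_r yx) => m0 w.
  have B := extremal_oct_ball w.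
  have E : norm2 (gradient (qform (- 1) (1 + 3 * omega (y / x))
      ((1 - 3 * omega (y / x) ^+ 2) / 2)) (x, y)) =
      2 * x * Num.sqrt (Hfun (y / x) (omega (y / x))).
    by rewrite norm2_gradient_qform// half_grad_sqr_extremal.
  have -> : bernstein (x, y) = 2 * x * Num.sqrt (Hfun (y / x) (omega (y / x))).
    apply: bernstein_eq => [a b c|]; last by do 3 eexists; split; [exact: B|].
    by apply: gradient_bound => //; rewrite y0.
  by [].
(* Reflection of [hP] in the diagonal. *)
have hQ : 0 < m -> x <= y ->
    bernstein (x, y) = 2 * m * Num.sqrt (Hfun r (omega r)) /\
    norm2 (gradient Q (x, y)) = bernstein (x, y).
  move=> m0 xy; have w := hw m0; move: m0 w.
  rewrite /Q /r /m (max_r xy) (min_l xy) => m0 w.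
  have B := extremal_oct_ball w.
  have E : norm2 (gradient (qform ((1 - 3 * omega (x / y) ^+ 2) / 2)
      (1 + 3 * omega (x / y)) (- 1)) (x, y)) =
      2 * y * Num.sqrt (Hfun (x / y) (omega (x / y))).
    by rewrite norm2_gradient_swap norm2_gradient_qform// half_grad_sqr_extremal.
  have -> : bernstein (x, y) = 2 * y * Num.sqrt (Hfun (x / y) (omega (x / y))).
    apply: bernstein_eq => [a b c /oct_ball_swap h|].
      by rewrite norm2_gradient_swap; apply: gradient_bound => //; rewrite x0.
    by do 3 eexists; split; [exact: oct_ball_swap B|].
  by [].
split.
- exact: bernstein0.
- move=> m0; split; first exact: hr.
  by have [yx|/ltW xy] := leP y x; [case: (hP m0 yx)|case: (hQ m0 xy)].
- move=> s hs; split; [exact: omega_bounds|exact: dcubic_omega|].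
  by move=> u; exact: dcubic_omega_uniq.
- move=> m0 yx; have [_ E] := hP m0 yx.
  have n1 : qoct_norm P = 1 by exact/qoct_norm_extremal/hw.
  by rewrite qoct_norm_opp n1 norm2_gradient_opp E.
- move=> m0 xy; have [_ E] := hQ m0 xy.
  have n1 : qoct_norm Q = 1 by rewrite qoct_norm_swap; exact/qoct_norm_extremal/hw.
  by rewrite qoct_norm_opp n1 norm2_gradient_opp E.
Qed.
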